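(* Let $\Omega$ be a bounded domain of class $C^0$ in $\mathbb{R}^2$. For each connected component $\mathcal{C}$ of $\partial\Omega$ there exists a point $P\in\mathcal{C}$ in the neighbourhood of which $\partial\Omega$ is Lipschitz.
   Context: A set $\Omega\subset\mathbb{R}^m$ ($m>1$) is a domain of class $C^0$ if $\Omega$ is a (nonempty) connected open set such that for every $P\in\partial\Omega$ there exist $\delta>0$, an orthonormal coordinate system $y=(y',y_m)$ with origin at $P$, and a continuous function $f:\mathbb{R}^{m-1}\to\mathbb{R}$ such that $\Omega\cap B(P,\delta)=\{y\in\mathbb{R}^m:y_m>f(y'),\ |y|<\delta\}$. The boundary $\partial\Omega$ is Lipschitz in a neighbourhood of $P\in\partial\Omega$ if for some $\delta>0$ and some orthonormal coordinate system with origin at $P$ such a representation holds with $f:\mathbb{R}^{m-1}\to\mathbb{R}$ Lipschitz. *)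

(* Defs.v *)
From HB Require Import structures.
From mathcomp Require Import all_boot all_order all_algebra.
From mathcomp Require Import all_classical all_reals all_analysis.
Set Implicit Arguments.
Unset Strict Implicit.
Unset Printing Implicit Defensive.
Import Order.TTheory GRing.Theory Num.Theory.
Import numFieldNormedType.Exports.
Local Open Scope classical_set_scope.
Local Open Scope ring_scope.

(* MathComp-Analysis endows 'rV[R]_m with the sup norm.  It has the same
   open, connected, bounded sets and the same Lipschitz functions as the
   Euclidean norm; only balls have to be defined with [enorm]. *)
Definition enorm (R : realType) (m : nat) (x : 'rV[R]_m) : R :=
  Num.sqrt (\sum_(i < m) x ord0 i ^+ 2).

Definition eball (R : realType) (m : nat) (P : 'rV[R]_m) (delta : R) :
  set 'rV[R]_m := [set x | enorm (x - P) < delta].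

Definition boundary (T : topologicalType) (A : set T) : set T :=
  closure A `\` interior A.

(* Coordinates of x in the system with origin P whose axes are the rows of E. *)
Definition coords (R : realType) (m : nat) (P : 'rV[R]_m) (E : 'M[R]_m)
  (x : 'rV[R]_m) : 'rV[R]_m := (x - P) *m E^T.

Definition orthonormal_rows (R : realType) (m : nat) (E : 'M[R]_m) : Prop :=
  E *m E^T = 1%:M.

(* y = (y', y_m) *)
Definition first_coords (R : realType) (n : nat) (y : 'rV[R]_n.+1) : 'rV[R]_n :=
  \row_(i < n) y ord0 (widen_ord (leqnSn n) i).

Definition last_coord (R : realType) (n : nat) (y : 'rV[R]_n.+1) : R :=
  y ord0 ord_max.

(* The ambient dimension is m = n.+2, that is, m > 1. *)
Definition epigraph_near (R : realType) (n : nat)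
    (regular : set ('rV[R]_n.+1 -> R)) (Omega : set 'rV[R]_n.+2)
    (P : 'rV[R]_n.+2) : Prop :=
  exists (delta : R) (E : 'M[R]_n.+2) (f : 'rV[R]_n.+1 -> R),
    [/\ 0 < delta, orthonormal_rows E, regular f
      & Omega `&` eball P delta =
        [set x | let y := coords P E x in
                 f (first_coords y) < last_coord y /\ enorm y < delta]].

Definition C0_domain (R : realType) (n : nat) (Omega : set 'rV[R]_n.+2) :
    Prop :=
  [/\ Omega !=set0, open Omega, connected Omega
    & forall P, boundary Omega P ->
        epigraph_near [set f : 'rV[R]_n.+1 -> R | continuous f] Omega P].

Definition boundary_lipschitz_near (R : realType) (n : nat)
    (Omega : set 'rV[R]_n.+2) (P : 'rV[R]_n.+2) : Prop :=
  epigraph_near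
    [set f : 'rV[R]_n.+1 -> R | [lipschitz (f x : R^o) | x in setT]] Omega P.

(* Main.v *)
(* Call a unit vector e good at P if near P the set Omega is the epigraph, in
   the direction e, of a continuous function.  A direction good at P is good at
   all points near P, and its opposite is not good at P.  If two independent
   directions e1, e2 are good at P, then near P the set Omega is stable under
   adding small vectors of the cone spanned by e1 and e2, so its boundary is
   Lipschitz near P.  Hence, if the boundary is Lipschitz at no point of C, each
   point of C has exactly one good direction; it is locally constant, therefore
   constant on the connected set C.  On the compact set C take a point P
   extremal in the orthogonal direction: following the graph through P one
   stays in C but goes beyond P, a contradiction. *)
Require Import Defs.
From HB Require Import structures.
From mathcomp Require Import all_boot all_order all_algebra.
From mathcomp Require Import all_classical all_reals all_analysis.
From mathcomp Require Import ring lra.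
Set Implicit Arguments.
Unset Strict Implicit.
Unset Printing Implicit Defensive.
Import Order.TTheory GRing.Theory Num.Theory.
Import numFieldNormedType.Exports.
Local Open Scope classical_set_scope.
Local Open Scope ring_scope.

(** * Coordinates, neighbourhoods and good directions in the plane *)

Notation xc x := (@fun_of_matrix _ 1 2 x ord0 ord0).
Notation yc x := (@fun_of_matrix _ 1 2 x ord0 ord_max).

(* For a unit vector [(c, d)], [along c d x] and [across c d x] are the
   coordinates of [x] in the orthonormal frame [(c, d), (d, -c)]. *)
Definition along (R : realType) (c d : R) (x : 'rV[R]_2) : R :=
  c * xc x + d * yc x.

Definition across (R : realType) (c d : R) (x : 'rV[R]_2) : R :=
  d * xc x - c * yc x.

(** The coordinates are not centred at [P], so that one [f] serves all points near [P]; openness of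
    the condition in [P] is then immediate. *)
Definition good_direction (R : realType) (Omega : set 'rV[R]_2) (c d : R)
    (P : 'rV[R]_2) : Prop :=
  c ^+ 2 + d ^+ 2 = 1 /\
  exists2 f : R -> R, continuous f
    & \forall x \near P, Omega x <-> f (across c d x) < along c d x.

Definition point (R : realType) (a b : R) : 'rV[R]_2 :=
  \row_i (if i == ord0 then a else b).

Lemma xc_point (R : realType) (a b : R) : xc (point a b) = a.
Proof. by rewrite mxE. Qed.

Lemma yc_point (R : realType) (a b : R) : yc (point a b) = b.
Proof. by rewrite mxE. Qed.

Lemma ord2_cases (i : 'I_2) : i = ord0 \/ i = ord_max.
Proof. by case: i => -[|[|//]] ?; [left|right]; exact: val_inj. Qed.

Lemma near_planeP (R : realType) (P : 'rV[R]_2) (S : set 'rV[R]_2) :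
  (\forall x \near P, S x) <->
  exists2 r : R, 0 < r &
    forall x, `|xc x - xc P| < r -> `|yc x - yc P| < r -> S x.
Proof.
split=> [/nbhs_ballP[r /= r0 rS]|[r r0 rS]].
  exists r => // x xr yr; apply: rS; split=> // i j.
  rewrite (ord1 i) /ball/= distrC.
  by have [->|->] := ord2_cases j.
apply/nbhs_ballP; exists r => //= x [_ Px]; apply: rS.
  by rewrite distrC; exact: Px.
by rewrite distrC; exact: Px.
Qed.

Lemma point_eta (R : realType) (x : 'rV[R]_2) : point (xc x) (yc x) = x.
Proof.
by apply/rowP => i; have [->|->] := ord2_cases i; rewrite mxE.
Qed.

Lemma point_continuous (R : realType) (f g : R -> R) :
  continuous f -> continuous g -> continuous (fun t => point (f t) (g t)).
Proof.
move=> fc gc t S /near_planeP[r r0 rS].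
have /cvgrPdist_lt/(_ _ r0) ft := fc t.
have /cvgrPdist_lt/(_ _ r0) gt := gc t.
rewrite nbhs_filterE /=; apply: filterS2 ft gt => s fts gts.
by apply: rS; rewrite !(xc_point, yc_point) distrC.
Qed.

Lemma linear_combination_continuous (R : realType) (T : topologicalType)
    (f g : T -> R) (a b : R) : continuous f -> continuous g ->
  continuous (fun x => a * f x + b * g x).
Proof.
by move=> fc gc x; apply: cvgD; apply: cvgM; (try exact: cvg_cst);
  [exact: fc|exact: gc].
Qed.

Lemma along_continuous (R : realType) (c d : R) : continuous (along c d).
Proof.
exact: (linear_combination_continuous
  (@coord_continuous R 1 2 ord0 ord0) (@coord_continuous R 1 2 ord0 ord_max)).
Qed.

Lemma across_continuous (R : realType) (c d : R) : continuous (across c d).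
Proof.
have -> : across c d = along d (- c).
  by apply/funext => x; rewrite /across /along mulNr.
exact: along_continuous.
Qed.

(** * Euclidean balls and the good direction of a chart *)

Lemma sum_ord2 (R : realType) (F : 'I_2 -> R) :
  \sum_(i < 2) F i = F ord0 + F ord_max.
Proof.
rewrite big_ord_recl big_ord1; congr (_ + F _); exact: val_inj.
Qed.

Lemma enorm_lt (R : realType) (x : 'rV[R]_2) (r : R) : 0 < r ->
  (enorm x < r) = (xc x ^+ 2 + yc x ^+ 2 < r ^+ 2).
Proof.
move=> r0; rewrite /enorm sum_ord2 -{1}(ger0_norm (ltW r0)) -sqrtr_sqr.
by rewrite ltr_sqrt// exprn_gt0.
Qed.

Lemma near_eball (R : realType) (P : 'rV[R]_2) (r : R) : 0 < r ->
  \forall x \near P, eball P r x.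
Proof.
move=> r0; apply/near_planeP; exists (r / 2) => [|x]; first lra.
rewrite /eball/= enorm_lt// !mxE !ltr_norml => /andP[x1 x2] /andP[y1 y2].
nra.
Qed.

(** The second row of [E] is the good direction [(c, d)]. Orthonormality forces the first row to be
    [(d, -c)] up to sign, and a reflection of the argument of [f] absorbs that sign. *)
Lemma epigraph_good_direction (R : realType) (Omega : set 'rV[R]_2) P :
  epigraph_near [set f : 'rV[R]_1 -> R | continuous f] Omega P ->
  exists c d, good_direction Omega c d P.
Proof.
move=> [r [E [f [r0 /matrixP EE fc OE]]]].
have := EE ord0 ord0; have := EE ord0 ord_max; have := EE ord_max ord_max.
rewrite !mxE !sum_ord2 !mxE /=.
set a := E ord0 ord0; set b := E ord0 ord_max.
set c := E ord_max ord0; set d := E ord_max ord_max.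
rewrite -!expr2 => cd1 acbd ab1.
exists c, d; split=> //.
(* The determinant of [E], equal to 1 or -1, is the sign in question. *)
pose e := a * d - b * c.
have aE : a = e * d.
  have -> : e * d = a * (c ^+ 2 + d ^+ 2) - c * (a * c + b * d).
    by rewrite /e; ring.
  by rewrite cd1 acbd; ring.
have bE : b = - (e * c).
  have -> : - (e * c) = b * (c ^+ 2 + d ^+ 2) - d * (a * c + b * d).
    by rewrite /e; ring.
  by rewrite cd1 acbd; ring.
have e2 : e ^+ 2 = 1.
  have -> : e ^+ 2 = (a ^+ 2 + b ^+ 2) * (c ^+ 2 + d ^+ 2)
      - (a * c + b * d) ^+ 2.
    by rewrite /e; ring.
  by rewrite ab1 cd1 acbd; ring.
(* The chart function rewritten for coordinates neither reflected nor centred at [P]. *)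
pose F u := f ((e * (u - across c d P)) *: const_mx 1) + along c d P.
exists F.
  move=> u; apply: cvgD; last exact: cvg_cst.
  apply: (@continuous_comp _ _ _
    (fun u : R => (e * (u - across c d P)) *: const_mx 1) f); last exact: fc.
  apply: cvgZ; last exact: cvg_cst.
  apply: cvgM; first exact: cvg_cst.
  by apply: cvgB; [exact: cvg_id|exact: cvg_cst].
near=> x.
have Bx : eball P r x by near: x; apply: near_eball.
have xE : first_coords (coords P E x) =
    (e * (across c d x - across c d P)) *: const_mx 1.
  apply/rowP => i; rewrite (ord1 i) !mxE sum_ord2 !mxE mulr1.
  have -> : widen_ord (leqnSn 1) ord0 = ord0 by exact: val_inj.
  by rewrite -/a -/b aE bE /across; ring.
have yE : last_coord (coords P E x) = along c d x - along c d P.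
  by rewrite /last_coord !mxE sum_ord2 !mxE -/c -/d /along; ring.
have EB : enorm (coords P E x) < r.
  move: Bx; rewrite /eball/= !enorm_lt// !mxE !sum_ord2 !mxE -/a -/b -/c -/d.
  congr (_ < _); move: (xc x - xc P) (yc x - yc P) => h k.
  rewrite aE bE.
  have -> : (h * (e * d) + k * - (e * c)) ^+ 2 + (h * c + k * d) ^+ 2 =
      e ^+ 2 * (h * d - k * c) ^+ 2 + (h * c + k * d) ^+ 2 by ring.
  rewrite e2; transitivity ((h ^+ 2 + k ^+ 2) * (c ^+ 2 + d ^+ 2)); last first.
    by ring.
  by rewrite cd1 mulr1.
have /(congr1 (fun S => S x))/= := OE.
rewrite xE yE /F ltrBrDr => OEx; split=> [Ox|fx].
  by have : Omega x /\ eball P r x by []; rewrite OEx => -[].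
by have [] : Omega x /\ eball P r x by rewrite OEx.
Unshelve. all: by end_near.
Qed.

Lemma good_direction_open (R : realType) (Omega : set 'rV[R]_2) c d :
  open [set P | good_direction Omega c d P].
Proof.
rewrite openE => P [cd [f fc /nbhs_interior PO]].
by apply: filterS PO => Q QO; split=> //; exists f.
Qed.

(** * Translations along a direction and the boundary as a graph *)

Definition shift (R : realType) (c d t : R) (x : 'rV[R]_2) : 'rV[R]_2 :=
  point (xc x + t * c) (yc x + t * d).

Lemma across_shift (R : realType) (c d t : R) x :
  across c d (shift c d t x) = across c d x.
Proof. by rewrite /across xc_point yc_point; ring. Qed.

Lemma along_shift (R : realType) (c d t : R) x : c ^+ 2 + d ^+ 2 = 1 ->
  along c d (shift c d t x) = along c d x + t.
Proof.
move=> cd; rewrite /along xc_point yc_point.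
transitivity (c * xc x + d * yc x + t * (c ^+ 2 + d ^+ 2)); first by ring.
by rewrite cd mulr1.
Qed.

Lemma shiftN (R : realType) (c d t : R) x :
  shift (- c) (- d) t x = shift c d (- t) x.
Proof. by rewrite /shift !mulrN !mulNr. Qed.

Lemma unit_coord_le1 (R : realType) (c d : R) : c ^+ 2 + d ^+ 2 = 1 ->
  `|c| <= 1 /\ `|d| <= 1.
Proof. by move=> cd; rewrite !ler_norml; split; apply/andP; split; nra. Qed.

Lemma shift_near (R : realType) (c d : R) (P : 'rV[R]_2) (S : set 'rV[R]_2) :
  c ^+ 2 + d ^+ 2 = 1 -> (\forall x \near P, S x) ->
  \forall t \near (0 : R)^'+, S (shift c d t P).
Proof.
move=> /unit_coord_le1[c1 d1] /near_planeP[r r0 rS].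
near=> t; have t0 : 0 < t by [].
have tr : t < r by near: t; exact: nbhs_right_lt.
apply: rS; rewrite !(xc_point, yc_point) addrAC subrr add0r normrM gtr0_norm//.
  by apply: le_lt_trans tr; rewrite ler_piMr// ltW.
by apply: le_lt_trans tr; rewrite ler_piMr// ltW.
Unshelve. all: by end_near.
Qed.

Lemma exists_shift (R : realType) (c d : R) (P : 'rV[R]_2) (S : set 'rV[R]_2) :
  c ^+ 2 + d ^+ 2 = 1 -> (\forall x \near P, S x) ->
  exists2 t : R, 0 < t & S (shift c d t P).
Proof.
move=> cd PS.
have [t []] := filter_ex (filterI (nbhs_right_gt 0) (shift_near cd PS)).
by exists t.
Qed.

(** As [Omega] is open, its boundary is its closure minus itself. Points strictly above the graph
    are in [Omega], points strictly below it have a neighbourhood that misses [Omega], and from a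
    point of the graph small shifts along [(c, d)] enter [Omega]. *)
Lemma boundary_graphP (R : realType) (Omega : set 'rV[R]_2) c d (f : R -> R) P :
  open Omega -> c ^+ 2 + d ^+ 2 = 1 -> continuous f ->
  (\forall x \near P, Omega x <-> f (across c d x) < along c d x) ->
  boundary Omega P <-> f (across c d P) = along c d P.
Proof.
move=> Oo cd fc fP.
rewrite /boundary (_ : interior Omega = Omega); last exact/interior_id.
split=> [[cP nP]|fE].
  apply/eqP; rewrite eq_le; apply/andP; split; last first.
    rewrite leNgt; apply/negP => lt; apply: nP.
    by apply/(nbhs_singleton fP).
  rewrite leNgt; apply/negP => lt.
  have : \forall x \near P, along c d x < f (across c d x).
    have Gc : continuous (fun x => 1 * f (across c d x) + -1 * along c d x).
      apply: linear_combination_continuous; last exact: along_continuous.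
      by move=> x; apply: continuous_comp; [exact: across_continuous|exact: fc].
    have := cvgr_gt _ (Gc P) 0.
    rewrite mul1r mulN1r subr_gt0 => /(_ (nbhs_filter P) lt).
    by apply: filterS => x; rewrite mul1r mulN1r subr_gt0.
  move=> lt'; have [x [Ox [xP ltx]]] := cP _ (filterI fP lt').
  by move/xP : Ox; rewrite ltNge ltW.
split; last by move/(nbhs_singleton fP); rewrite fE ltxx.
move=> S /(filterI fP)/(exists_shift cd)[t t0 [Ox Sx]].
exists (shift c d t P); split=> //.
by apply/Ox; rewrite across_shift along_shift// fE ltrDl.
Qed.

(** A short step from [P] along [(c, d)] enters [Omega] by the first representation, while the
    second one puts the same point strictly below its graph. *)
Lemma good_direction_opp (R : realType) (Omega : set 'rV[R]_2) c d P :
  open Omega -> boundary Omega P ->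
  good_direction Omega c d P -> ~ good_direction Omega (- c) (- d) P.
Proof.
move=> Oo bP [cd [f fc fP]] [cd' [g gc gP]].
have fE := (boundary_graphP Oo cd fc fP).1 bP.
have gE := (boundary_graphP Oo cd' gc gP).1 bP.
have [t t0 [fx gx]] := exists_shift cd (filterI fP gP).
have : Omega (shift c d t P).
  by apply/fx; rewrite across_shift along_shift// fE ltrDl.
move/gx.
have acrossN x : across (- c) (- d) x = - across c d x by rewrite /across; ring.
have alongN x : along (- c) (- d) x = - along c d x by rewrite /along; ring.
move: gE; rewrite !(acrossN, alongN) across_shift along_shift// => ->.
by rewrite ltrN2 gtrDl ltNge ltW.
Qed.

(** * Rotated frames and the cone criterion for a Lipschitz boundary *)

Lemma enorm_frame (R : realType) (c d : R) (x : 'rV[R]_2) (r : R) : 0 < r ->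
  c ^+ 2 + d ^+ 2 = 1 ->
  (enorm x < r) = (across c d x ^+ 2 + along c d x ^+ 2 < r ^+ 2).
Proof.
move=> r0 cd; rewrite enorm_lt//; congr (_ < _).
rewrite -[LHS]mul1r -cd /across /along; ring.
Qed.

Lemma alongB (R : realType) (c d : R) x y :
  along c d (x - y) = along c d x - along c d y.
Proof. by rewrite /along !mxE; ring. Qed.

Lemma acrossB (R : realType) (c d : R) x y :
  across c d (x - y) = across c d x - across c d y.
Proof. by rewrite /across !mxE; ring. Qed.

Lemma eball_frame (R : realType) (c d : R) (P x : 'rV[R]_2) (r : R) : 0 < r ->
  c ^+ 2 + d ^+ 2 = 1 -> eball P r x <->
  (across c d x - across c d P) ^+ 2 + (along c d x - along c d P) ^+ 2
    < r ^+ 2.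
Proof.
by move=> r0 cd; rewrite /eball/= (enorm_frame _ r0 cd) alongB acrossB.
Qed.

Lemma coord_le_norm (R : realType) (m n : nat) (x : 'M[R]_(m, n)) i j :
  `|x i j| <= `|x|.
Proof.
rewrite [leRHS]/Num.norm/= mx_normrE.
by apply: (le_bigmax _ (fun ij : 'I_m * 'I_n => `|x ij.1 ij.2|) (i, j)).
Qed.

(** The axis [(c, d)] is the last row because [epigraph_near] takes the last coordinate as the
    vertical one. *)
Definition frame (R : realType) (c d : R) : 'M[R]_2 :=
  \matrix_(i, j) if i == ord0 then if j == ord0 then d else - c
                 else if j == ord0 then c else d.

Lemma frame_orthonormal (R : realType) (c d : R) : c ^+ 2 + d ^+ 2 = 1 ->
  orthonormal_rows (frame c d).
Proof.
move=> cd; apply/matrixP => i j.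
by have [->|->] := ord2_cases i; have [->|->] := ord2_cases j;
  rewrite !mxE sum_ord2 !mxE /= ?mulr1n ?mulr0n -?cd; ring.
Qed.

Lemma first_coords_frame (R : realType) (c d : R) P x i j :
  first_coords (coords P (frame c d) x) i j = across c d x - across c d P.
Proof.
have w0 : widen_ord (leqnSn 1) j = ord0.
  by rewrite (ord1 j); exact: val_inj.
by rewrite !mxE w0 sum_ord2 !mxE /= /across; ring.
Qed.

Lemma last_coord_frame (R : realType) (c d : R) P x :
  last_coord (coords P (frame c d) x) = along c d x - along c d P.
Proof. by rewrite /last_coord !mxE sum_ord2 !mxE /= /along; ring. Qed.

Lemma enorm_coords_frame (R : realType) (c d r : R) P x : 0 < r ->
  c ^+ 2 + d ^+ 2 = 1 ->
  enorm (coords P (frame c d) x) < r <-> eball P r x.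
Proof.
move=> r0 cd; apply: iff_trans (iff_sym (eball_frame P x r0 cd)).
rewrite enorm_lt//.
have -> : yc (coords P (frame c d) x) = along c d x - along c d P.
  exact: last_coord_frame.
have <- : xc (coords P (frame c d) x) = across c d x - across c d P.
  by rewrite !mxE sum_ord2 !mxE /= /across; ring.
by [].
Qed.

Lemma sqr_sum_lt (R : realType) (a b r : R) : 0 < r ->
  a ^+ 2 + b ^+ 2 < r ^+ 2 -> `|b| < r.
Proof.
move=> r0 abr; rewrite ltNge; apply/negP => rb.
have : r ^+ 2 <= `|b| ^+ 2 by rewrite lerXn2r// nnegrE ltW.
by rewrite real_normK ?num_real// leNgt (le_lt_trans _ abr)// lerDr sqr_ge0.
Qed.

(** Inside the ball, [Omega] is the union of the open upward cones of slope [L] with apex in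
    [Omega], that is, the strict epigraph of the infimum of the functions bounding these cones. *)
Lemma cone_monotone_lipschitz (R : realType) (Omega : set 'rV[R]_2) c d P
    (L r : R) :
  open Omega -> closure Omega P -> c ^+ 2 + d ^+ 2 = 1 -> 0 <= L -> 0 < r ->
  (forall x y, eball P r x -> eball P r y -> Omega x ->
    L * `|across c d y - across c d x| < along c d y - along c d x ->
    Omega y) ->
  boundary_lipschitz_near Omega P.
Proof.
move=> Oo cP cd L0 r0 cone.
(* An infimum of L-Lipschitz functions: no extension to the whole line is
   needed. *)
pose A u := [set along c d z + L * `|u - across c d z|
            | z in Omega `&` eball P r].
have A0 u : A u !=set0.
  have [z [Oz Bz]] := cP _ (near_eball P r0).
  by exists (along c d z + L * `|u - across c d z|); exists z.
have Alb u : has_lbound (A u).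
  exists (along c d P - r) => _ [z [_ /(eball_frame _ _ r0 cd) Bz] <-].
  have : 0 <= L * `|u - across c d z| by rewrite mulr_ge0.
  suff : along c d P - r <= along c d z by lra.
  by move/(sqr_sum_lt r0) : Bz; rewrite ltr_norml => /andP[]; lra.
have subrD2r (u v w : R) : u + w - (v + w) = u - v by ring.
pose F u := inf (A u).
have Flip u v : F u <= F v + L * `|u - v|.
  rewrite -lerBlDr; apply: lb_le_inf => // _ [z Oz <-].
  rewrite lerBlDr.
  apply: (@le_trans _ _ (along c d z + L * `|u - across c d z|)).
    by apply: ge_inf => //; exists z.
  by have := ler_wpM2l L0 (ler_distD v u (across c d z)); lra.
(* [F] is written in uncentred coordinates; the chart has its origin at [P]. *)
exists r, (frame c d), (fun h => F (h ord0 ord0 + across c d P) - along c d P).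
split => //.
- exact: frame_orthonormal.
- apply: (@klipschitzW _ _ _ L) => [|[x y] _ /=].
    exact: (@globally_properfilter _ _ (0, 0)).
  apply: (@le_trans _ _ (L * `|x ord0 ord0 - y ord0 ord0|)); last first.
    rewrite ler_wpM2l//.
    by have := coord_le_norm (x - y) ord0 ord0; rewrite !mxE.
  have := Flip (x ord0 ord0 + across c d P) (y ord0 ord0 + across c d P).
  have := Flip (y ord0 ord0 + across c d P) (x ord0 ord0 + across c d P).
  rewrite !subrD2r (distrC (y ord0 ord0)) ler_norml => *.
  by apply/andP; split; lra.
- apply/seteqP; split=> x /=; rewrite first_coords_frame last_coord_frame subrK
    (enorm_coords_frame _ _ r0 cd) ltrD2r => -[].
  + move=> Ox Bx; split => //.
    have cdN : (- c) ^+ 2 + (- d) ^+ 2 = 1 by rewrite !sqrrN.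
    (* For the strict inequality, [x] needs an apex of [Omega] strictly below it and still in the
       ball. Lowering [x] by [t < r] adds less than [3 * r * t] to its squared distance to [P],
       whence the third bound. *)
    have : \forall t \near (0 : R)^'+, [/\ 0 < t, t < r,
        t < (r ^+ 2 - ((across c d x - across c d P) ^+ 2 +
             (along c d x - along c d P) ^+ 2)) / (3 * r)
        & Omega (shift (- c) (- d) t x)].
      near=> t; split; near: t.
      - exact: nbhs_right_gt.
      - exact: nbhs_right_lt.
      - apply: nbhs_right_lt; rewrite divr_gt0 ?mulr_gt0// subr_gt0.
        exact/eball_frame.
      - by apply: shift_near cdN _; exact: open_nbhs_nbhs.
    move=> /filter_ex[t [t0 tr]].
    rewrite ltr_pdivlMr ?mulr_gt0// => tq.
    rewrite shiftN => Ot.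
    have Bt : eball P r (shift c d (- t) x).
      move/(eball_frame _ _ r0 cd) : Bx => Bx.
      apply/(eball_frame _ _ r0 cd); rewrite across_shift along_shift//.
      move: Bx tq; move: (across c d x - across c d P).
      move: (along c d x) (along c d P) => k p h Bx tq.
      have := sqr_sum_lt r0 Bx; rewrite ltr_norml => /andP[kr _].
      have : 0 < t * ((r - t) + (k - p + r) * 2) by rewrite mulr_gt0//; lra.
      by rewrite !expr2 in Bx tq *; lra.
    apply: (@le_lt_trans _ _ (along c d x - t)); last by rewrite gtrDl oppr_lt0.
    apply: ge_inf => //; exists (shift c d (- t) x) => //.
    by rewrite across_shift along_shift// subrr normr0 mulr0 addr0.
  + move=> FAx Bx; split=> //.
    (* A point strictly above the infimum lies in the open cone over some apex [z]. *)
    have [_ [z [Oz Bz] <-] zx] := inf_lt (A0 _) FAx.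
    by apply: cone Bz Bx Oz _; lra.
Unshelve. all: by end_near.
Qed.

(** * Two independent good directions at one point *)

Lemma good_direction_monotone (R : realType) (Omega : set 'rV[R]_2) c d P :
  good_direction Omega c d P ->
  exists2 r : R, 0 < r & forall x t, 0 <= t ->
    `|xc x - xc P| < r -> `|yc x - yc P| < r ->
    `|xc (shift c d t x) - xc P| < r -> `|yc (shift c d t x) - yc P| < r ->
    Omega x -> Omega (shift c d t x).
Proof.
move=> [cd [f fc /near_planeP[r r0 fr]]]; exists r => // x t t0 x1 x2 y1 y2.
move=> /(fr _ x1 x2) fx; apply/(fr _ y1 y2).
by rewrite across_shift along_shift//; apply: lt_le_trans fx _; rewrite lerDl.
Qed.

Lemma eball_coord (R : realType) (P x : 'rV[R]_2) (r : R) : 0 < r ->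
  eball P r x -> `|xc x - xc P| < r /\ `|yc x - yc P| < r.
Proof.
rewrite /eball/= => r0; rewrite enorm_lt// !mxE => h; split.
  by apply: (sqr_sum_lt (a := yc x - yc P) r0); rewrite addrC.
exact: sqr_sum_lt h.
Qed.

(* The axis of the cone spanned by the two directions is their bisector, and
   [N2] is the squared norm of their sum. *)
Lemma independent_directions_lipschitz (R : realType) (Omega : set 'rV[R]_2)
    (c1 d1 c2 d2 : R) P :
  open Omega -> boundary Omega P ->
  good_direction Omega c1 d1 P -> good_direction Omega c2 d2 P ->
  0 < c1 * d2 - c2 * d1 -> boundary_lipschitz_near Omega P.
Proof.
move=> Oo [cP _] g1 g2.
have [u1 _] := g1; have [u2 _] := g2.
have [r1 r10 m1] := good_direction_monotone g1.
have [r2 r20 m2] := good_direction_monotone g2.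
(* [D] and [q] are the sine and cosine of the angle between the directions; [D > 0] excludes
   opposite ones, so their sum is nonzero. *)
pose D := c1 * d2 - c2 * d1; rewrite -/D => D0.
pose q := c1 * c2 + d1 * d2.
have qD : q ^+ 2 + D ^+ 2 = 1.
  transitivity ((c1 ^+ 2 + d1 ^+ 2) * (c2 ^+ 2 + d2 ^+ 2)).
    by rewrite /q /D; ring.
  by rewrite u1 u2 mulr1.
have D1 : D <= 1 by nra.
have q1 : -1 < q by nra.
pose N2 := (c1 + c2) ^+ 2 + (d1 + d2) ^+ 2.
have N2E : N2 = 2 * (1 + q).
  transitivity ((c1 ^+ 2 + d1 ^+ 2) + (c2 ^+ 2 + d2 ^+ 2) + 2 * q).
    by rewrite /N2 /q; ring.
  by rewrite u1 u2; ring.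
have N20 : 0 < N2 by rewrite N2E; lra.
pose N := Num.sqrt N2.
have N0 : 0 < N by rewrite sqrtr_gt0.
have NN : N ^+ 2 = N2 by rewrite sqr_sqrtr// ltW.
pose c := (c1 + c2) / N; pose d := (d1 + d2) / N.
have cd : c ^+ 2 + d ^+ 2 = 1.
  by rewrite /c /d !expr_div_n -mulrDl NN divff// gt_eqF.
pose m := Num.min r1 r2.
have m0 : 0 < m by rewrite lt_min r10.
have [mr1 mr2] : m <= r1 /\ m <= r2 by rewrite !ge_min !lexx ?orbT.
(* For [x] and [y] in the ball, the first step [s] below is at most [4 * r / D], which is
   [4 * m / 5]; with [r <= m / 5], the intermediate point [z] stays within [m] of [P] in each
   coordinate. *)
pose r := m * D / 5.
have r0 : 0 < r by rewrite !mulr_gt0.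
have rm : r * 5 <= m.
  by rewrite /r divfK ?pnatr_eq0// ler_piMr// ltW.
(* The slope is [(1 + q) / D], the cotangent of half the angle. *)
apply: (@cone_monotone_lipschitz _ _ c d _ (N2 / (2 * D)) r) => //.
  by rewrite divr_ge0 ?mulr_ge0// ltW.
move=> x y /(eball_coord r0)[x1 x2] /(eball_coord r0)[y1 y2] Ox.
pose h := xc y - xc x; pose k := yc y - yc x.
pose A := (d1 + d2) * h - (c1 + c2) * k.
pose B := (c1 + c2) * h + (d1 + d2) * k.
have -> : across c d y - across c d x = A / N.
  by rewrite /across /c /d /A /h /k; ring.
have -> : along c d y - along c d x = B / N.
  by rewrite /along /c /d /B /h /k; ring.
rewrite normrM [`|N^-1|]gtr0_norm ?invr_gt0// mulrA ltr_pM2r ?invr_gt0//.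
rewrite mulrAC ltr_pdivrMr ?mulr_gt0// => AB.
(* Cramer's rule for the displacement from [x] to [y] in the basis of the two directions. The next
   two identities show that the cone condition makes both coefficients nonnegative. *)
pose s := (h * d2 - k * c2) / D; pose t := (c1 * k - d1 * h) / D.
have sE : s * (2 * D * N2) = 2 * D * B + N2 * A.
  rewrite (_ : s * (2 * D * N2) = 2 * N2 * (h * d2 - k * c2)); last first.
    by rewrite /s; field; rewrite gt_eqF.
  apply/eqP; rewrite -subr_eq0; apply/eqP.
  rewrite N2E.
  (* The difference of the two sides is a combination of the defects from unit length, which
     vanish. *)
  transitivity (2 * (h * (d2 * (1 - (c1 ^+ 2 + d1 ^+ 2))
       - d1 * (1 - (c2 ^+ 2 + d2 ^+ 2)))
     + k * (c1 * (1 - (c2 ^+ 2 + d2 ^+ 2))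
       - c2 * (1 - (c1 ^+ 2 + d1 ^+ 2))))).
    by rewrite /A /B /q /D; ring.
  by rewrite u1 u2; ring.
have tE : t * (2 * D * N2) = 2 * D * B - N2 * A.
  rewrite (_ : t * (2 * D * N2) = 2 * N2 * (c1 * k - d1 * h)); last first.
    by rewrite /t; field; rewrite gt_eqF.
  apply/eqP; rewrite -subr_eq0; apply/eqP.
  rewrite N2E.
  transitivity (2 * (h * (d2 * (1 - (c1 ^+ 2 + d1 ^+ 2))
       - d1 * (1 - (c2 ^+ 2 + d2 ^+ 2)))
     + k * (c1 * (1 - (c2 ^+ 2 + d2 ^+ 2))
       - c2 * (1 - (c1 ^+ 2 + d1 ^+ 2))))).
    by rewrite /A /B /q /D; ring.
  by rewrite u1 u2; ring.
have P0 : 0 < 2 * D * N2 by rewrite !mulr_gt0.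
have NA : `|N2 * A| < 2 * D * B.
  by rewrite normrM (gtr0_norm N20) mulrC [ltRHS]mulrC [B * _]mulrC; lra.
have s0 : 0 <= s.
  by rewrite -(pmulr_lge0 _ P0) sE; move: NA; rewrite ltr_norml => /andP[]; lra.
have t0 : 0 <= t.
  by rewrite -(pmulr_lge0 _ P0) tE; move: NA; rewrite ltr_norml => /andP[]; lra.
have [c11 d11] := unit_coord_le1 u1.
have [c21 d21] := unit_coord_le1 u2.
have le_prod (a b : R) : `|a| <= 2 * r -> `|b| <= 1 -> `|a * b| <= 2 * r.
  by move=> ar b1; rewrite normrM -[leRHS]mulr1 ler_pM.
have sr : s * 5 <= m * 4.
  rewrite -(ler_pM2r D0) mulrAC /s divfK ?gt_eqF//.
  have : `|h * d2| <= 2 * r.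
    apply: le_prod => //; move: x1 y1; rewrite /h !ltr_norml ler_norml.
    by move=> /andP[? ?] /andP[? ?]; apply/andP; split; lra.
  have : `|k * c2| <= 2 * r.
    apply: le_prod => //; move: x2 y2; rewrite /k !ltr_norml ler_norml.
    by move=> /andP[? ?] /andP[? ?]; apply/andP; split; lra.
  by rewrite !ler_norml /r => /andP[? ?] /andP[? ?]; lra.
have step (a b : R) : `|a| < r -> `|b| <= 1 -> `|a + s * b| < m.
  move=> ar b1; apply: le_lt_trans (ler_normD _ _) _.
  have : `|s * b| <= s by rewrite normrM ger0_norm// ler_piMr.
  by lra.
pose z := shift c1 d1 s x.
have yE : y = shift c2 d2 t z.
  rewrite -[y]point_eta /shift; congr point; rewrite !(xc_point, yc_point);
    rewrite /s /t /D /h /k; field; rewrite -/D gt_eqF//.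
have z1 : `|xc z - xc P| < m.
  by rewrite xc_point addrAC; exact: step.
have z2 : `|yc z - yc P| < m.
  by rewrite yc_point addrAC; exact: step.
have rm' : r < m by lra.
have Oz : Omega z.
  by apply: m1 => //; apply: lt_le_trans mr1 => //; apply: lt_trans rm'.
rewrite yE; apply: m2 => //; rewrite -?yE; apply: lt_le_trans mr2 => //;
  exact: lt_trans rm'.
Qed.

(** * Uniqueness and constancy of the good direction *)

Lemma sqr_sum_eq0 (R : realType) (a b : R) :
  a ^+ 2 + b ^+ 2 = 0 -> a = 0 /\ b = 0.
Proof.
move/eqP; rewrite paddr_eq0 ?sqr_ge0// !sqrf_eq0 => /andP[/eqP -> /eqP ->].
by [].
Qed.

(** A nonzero determinant, of either sign after a swap, would make the boundary Lipschitz. A zero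
    one leaves equal or opposite unit vectors, and opposite ones cannot both be good. *)
Lemma good_direction_unique (R : realType) (Omega : set 'rV[R]_2)
    (c1 d1 c2 d2 : R) P :
  open Omega -> boundary Omega P -> ~ boundary_lipschitz_near Omega P ->
  good_direction Omega c1 d1 P -> good_direction Omega c2 d2 P ->
  c1 = c2 /\ d1 = d2.
Proof.
move=> Oo bP nL g1 g2; have [u1 _] := g1; have [u2 _] := g2.
have [D0|D0|D0] := ltgtP 0 (c1 * d2 - c2 * d1).
- by have := independent_directions_lipschitz Oo bP g1 g2 D0.
- have D0' : 0 < c2 * d1 - c1 * d2 by lra.
  by have := independent_directions_lipschitz Oo bP g2 g1 D0'.
pose q := c1 * c2 + d1 * d2.
have : (q - 1) * (q + 1) = 0.
  transitivity ((c1 ^+ 2 + d1 ^+ 2) * (c2 ^+ 2 + d2 ^+ 2)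
    - (c1 * d2 - c2 * d1) ^+ 2 - 1); first by rewrite /q; ring.
  by rewrite u1 u2 -D0; ring.
move=> /eqP; rewrite mulf_eq0 => /orP[] /eqP q1.
  have [] : c1 - c2 = 0 /\ d1 - d2 = 0.
    apply: sqr_sum_eq0; transitivity
      ((c1 ^+ 2 + d1 ^+ 2) + (c2 ^+ 2 + d2 ^+ 2) - 2 * (q - 1) - 2).
      by rewrite /q; ring.
    by rewrite u1 u2 q1; ring.
  by move=> /subr0_eq -> /subr0_eq ->.
have [c12 d12] : c2 + c1 = 0 /\ d2 + d1 = 0.
  apply: sqr_sum_eq0; transitivity
    ((c1 ^+ 2 + d1 ^+ 2) + (c2 ^+ 2 + d2 ^+ 2) + 2 * (q + 1) - 2).
    by rewrite /q; ring.
  by rewrite u1 u2 q1; ring.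
exfalso; apply: (good_direction_opp Oo bP g1).
by move/addr0_eq : c12 => <-; move/addr0_eq : d12 => <-; rewrite !opprK.
Qed.

(* A direction good at a boundary point stays good nearby, so by uniqueness the
   sets of boundary points with a given good direction are relatively clopen. *)
Lemma good_direction_constant (R : realType) (Omega C : set 'rV[R]_2) c d P :
  open Omega -> connected C -> C `<=` boundary Omega ->
  (forall Q, C Q -> ~ boundary_lipschitz_near Omega Q) ->
  (forall Q, C Q -> exists c d, good_direction Omega c d Q) ->
  C P -> good_direction Omega c d P ->
  forall Q, C Q -> good_direction Omega c d Q.
Proof.
move=> Oo Cc CO nL ex CP gP.
(* Within [C], existence and uniqueness make the open set [W] the complement of the points where
   [(c, d)] is good, which gives relative closedness. *)
pose W := \bigcup_(e in [set e : R * R | e != (c, d)])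
  [set Q | good_direction Omega e.1 e.2 Q].
suff : C `&` [set Q | good_direction Omega c d Q] = C.
  by move=> CE Q; rewrite -{1}CE => -[].
apply: Cc.
- by exists P.
- exists [set Q | good_direction Omega c d Q] => //.
  exact: good_direction_open.
exists (~` W).
  by apply: open_closedC; apply: bigcup_open => e _; exact: good_direction_open.
apply/seteqP; split=> Q [CQ /= gQ]; split=> //=.
  move=> [[c' d'] /= /eqP ne g']; apply: ne.
  by have [-> ->] := good_direction_unique Oo (CO _ CQ) (nL _ CQ) gQ g'.
have [c' [d' g']] := ex _ CQ.
have [e|ne] := eqVneq (c', d') (c, d).
  by case: e g' => -> ->.
by exfalso; apply: gQ; exists (c', d').
Qed.

(** * Compactness and the extremal point *)

Lemma boundary_bounded (R : realType) (n : nat) (Omega : set 'rV[R]_n) :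
  bounded_set Omega -> bounded_set (boundary Omega).
Proof.
move=> [M [Mr MO]]; exists M; split=> // N MN x [cx _] /=.
apply/ler_addgt0Pr => e e0.
have [y [Oy xy]] := cx _ (nbhsx_ballx x e e0).
have := MO N MN y Oy; move: xy; rewrite -ball_normE /= => xy yN.
by have := ler_normD (x - y) y; rewrite subrK; lra.
Qed.

(* Following the graph through [P] shows that [across c d] has no local maximum
   at [P] on the boundary component of [P]. *)
Lemma component_extends (R : realType) (Omega : set 'rV[R]_2) c d P :
  open Omega -> boundary Omega P -> good_direction Omega c d P ->
  exists2 Q, connected_component (boundary Omega) P Q
    & across c d P < across c d Q.
Proof.
move=> Oo bP [cd [f fc fP]].
(* The point with [across] coordinate [u] and [along] coordinate [f u], a parametrization of the
   graph. *)
pose g u := point (d * u + c * f u) (- c * u + d * f u).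
have gc : continuous g.
  by apply: point_continuous; apply: linear_combination_continuous => //;
    move=> x; exact: cvg_id.
have acg u : across c d (g u) = u.
  rewrite /across xc_point yc_point.
  by transitivity ((c ^+ 2 + d ^+ 2) * u); [ring|rewrite cd mul1r].
have alg u : along c d (g u) = f u.
  rewrite /along xc_point yc_point.
  by transitivity ((c ^+ 2 + d ^+ 2) * f u); [ring|rewrite cd mul1r].
have fE := (boundary_graphP Oo cd fc fP).1 bP.
have gP : g (across c d P) = P.
  rewrite /g fE -[RHS]point_eta /across /along; congr point.
    by transitivity ((c ^+ 2 + d ^+ 2) * xc P); [ring|rewrite cd mul1r].
  by transitivity ((c ^+ 2 + d ^+ 2) * yc P); [ring|rewrite cd mul1r].
have : \forall u \near across c d P, boundary Omega (g u).
  (* [boundary_graphP] needs the representation on a neighbourhood of [g u], hence the passage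
     through [nbhs_interior]. *)
  have : \forall u \near across c d P,
      \forall x \near g u, Omega x <-> f (across c d x) < along c d x.
    by move: (nbhs_interior fP); rewrite -{1}gP => /(gc _).
  apply: filterS => u gu; apply/(boundary_graphP Oo cd fc gu).
  by rewrite acg alg.
move=> /nbhs_ballP[e /= e0 eB].
(* Half of [e] keeps the closed interval inside the ball; its image under [g] is a connected piece
   of the boundary through [P]. *)
pose I := `[across c d P, across c d P + e / 2]%classic : set R.
have IP : I (across c d P) by rewrite /I /= in_itv /= lexx; lra.
exists (g (across c d P + e / 2)); last by rewrite acg; lra.
apply: (@connected_component_max _ _ (g @` I)).
- by exists (across c d P).
- move=> _ [u uI <-]; apply: eB; rewrite /ball /= distrC.
  move: uI; rewrite /I /= in_itv /= ltr_norml => /andP[? ?].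
  by apply/andP; split; lra.
- apply: connected_continuous_connected.
    by apply/connected_intervalP; exact: interval_is_interval.
  by apply: continuous_subspaceT => x; exact: gc.
- exists (across c d P + e / 2) => //.
  by rewrite /I /= in_itv /= lexx andbT; lra.
Qed.

Unset Implicit Arguments.

Theorem theorem7p2 (R : realType) (Omega : set 'rV[R]_2)
    (bounded_Omega : bounded_set Omega) (C0_Omega : C0_domain Omega)
    (C : set 'rV[R]_2)
    (C_component : exists2 x : 'rV[R]_2,
       boundary Omega x & C = connected_component (boundary Omega) x) :
  exists2 P : 'rV[R]_2, C P & boundary_lipschitz_near Omega P.
Proof.
have [_ Oo _ epi] := C0_Omega; have [x bx CE] := C_component.
apply: contrapT => /forall2NP nL'.
have nL Q : C Q -> ~ boundary_lipschitz_near Omega Q.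
  by move=> CQ; case: (nL' Q).
have CO : C `<=` boundary Omega by rewrite CE; exact: connected_component_sub.
have good Q : C Q -> exists c d, good_direction Omega c d Q.
  by move=> /CO /epi; exact: epigraph_good_direction.
have Cx : C x by rewrite CE; exact: connected_component_refl.
have [c [d gx]] := good x Cx.
have Cconn : connected C by rewrite CE; exact: component_connected.
have gC := good_direction_constant Oo Cconn CO nL good Cx gx.
have bclosed : closed (boundary Omega).
  apply: closedI; first exact: closed_closure.
  exact/open_closedC/open_interior.
have Ccpt : compact C.
  rewrite CE; apply: (subclosed_compact (component_closed bclosed)).
    exact: bounded_closed_compact (boundary_bounded bounded_Omega) bclosed.
  exact: connected_component_sub.
(* The extremal point is taken for [across c d], the coordinate orthogonal to the common good
   direction. *)
have [| |P /set_mem CP maxP] := compact_EVT_max (f := across c d) _ Ccpt.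
- by exists x.
- by apply: continuous_subspaceT => y; exact: across_continuous.
have [Q PQ] := component_extends Oo (CO _ CP) (gC _ CP).
rewrite ltNge => /negP; apply; apply: maxP; apply/mem_set.
by rewrite CE; apply: connected_component_trans PQ; rewrite -CE.
Qed.
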